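(* Let $\mathcal{X}$ be a real Banach space with $\dim(\mathcal{X})\ge 2$ and let $\kappa,\tau>0$. Then $$\mathcal{T}_2(\kappa,\tau,\mathcal{X})^2\le 2\kappa^2\, C'_{NJ}(\mathcal{X})+2\sqrt{2}\,\kappa|\kappa-\tau|\sqrt{C'_{NJ}(\mathcal{X})}+(\kappa-\tau)^2.$$
   Context: $S_{\mathcal{X}}$ denotes the unit sphere of $\mathcal{X}$. For $\kappa,\tau>0$, $$\mathcal{T}_2(\kappa,\tau,\mathcal{X})=\sup_{x_1,x_2\in S_{\mathcal{X}}}\big(\|\kappa x_1+\tau x_2\|\,\|\tau x_1-\kappa x_2\|\big)^{1/2}.$$ Also $$C'_{NJ}(\mathcal{X})=\sup\left\{\frac{\|x_1+x_2\|^2+\|x_1-x_2\|^2}{4}:\ x_1,x_2\in S_{\mathcal{X}}\right\}.$$ *)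

(* Defs.v *)
From HB Require Import structures.
From mathcomp Require Import all_boot all_order all_algebra.
From mathcomp Require Import all_classical all_reals all_analysis.
Set Implicit Arguments.
Unset Strict Implicit.
Unset Printing Implicit Defensive.
Import Order.TTheory GRing.Theory Num.Theory numFieldNormedType.Exports.
Local Open Scope classical_set_scope.
Local Open Scope ring_scope.

(* [dim X >= n], for a space that may be infinite-dimensional: X contains n
   linearly independent vectors. *)
Definition dim_ge (R : realType) (X : lmodType R) (n : nat) : Prop :=
  exists v : 'I_n -> X, forall c : 'I_n -> R,
    \sum_(i < n) c i *: v i = 0 -> forall i, c i = 0.

Definition unit_sphere (R : realType) (X : normedModType R) : set X :=
  [set x : X | `|x| = 1].
Arguments unit_sphere {R} X.

(* Both suprema below are taken over sets that are bounded (by `|k| + `|t| and by 2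
   respectively), and nonempty as soon as X is nonzero, so the default value 0
   of [sup] plays no role when [dim_ge X 2]. *)
Definition T2 (R : realType) (k t : R) (X : normedModType R) : R :=
  sup [set Num.sqrt (`|k *: x1 + t *: x2| * `|t *: x1 - k *: x2|)
      | x1 in unit_sphere X & x2 in unit_sphere X].

Definition CNJ' (R : realType) (X : normedModType R) : R :=
  sup [set (`|x1 + x2| ^+ 2 + `|x1 - x2| ^+ 2) / 4
      | x1 in unit_sphere X & x2 in unit_sphere X].

(* Main.v *)
Require Import Defs.
From mathcomp Require Import all_boot all_order all_algebra.
From mathcomp Require Import all_classical all_reals all_analysis.
From mathcomp Require Import ring lra.
Import Order.TTheory GRing.Theory Num.Theory numFieldNormedType.Exports.
Local Open Scope ring_scope.

(** For unit vectors [x], [y] put [a = `|x + y|], [b = `|x - y|], [d = `|k - t|].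
    The vectors [k *: x + t *: y] and [t *: x - k *: y] differ from
    [k *: (x + y)] and [k *: (x - y)] by [t - k] times a unit vector, so their
    norms are at most [k * a + d] and [k * b + d]
    ([norm_product_perturb]).  The product of these two bounds is
    [k ^+ 2 * (a * b) + k * d * (a + b) + d ^+ 2], and since
    [a ^+ 2 + b ^+ 2 <= 4 * CNJ' X] ([le_CNJ']), the arithmetic-geometric and
    quadratic mean inequalities give [a * b <= 2 * CNJ' X] and
    [a + b <= 2 * Num.sqrt 2 * Num.sqrt (CNJ' X)] ([mul_le_of_sumsqr],
    [add_le_of_sumsqr]).  The resulting bound does not depend on [x] and [y],
    hence passes to the supremum ([sup_sqr_le]). *)

Lemma sup_ge0 (R : realType) (A : set R) :
  (forall x, A x -> 0 <= x) -> 0 <= sup A.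
Proof.
move=> A0; have [[[x Ax] ubA]|nsup] := pselect (has_sup A).
  by apply: le_trans (A0 x Ax) _; exact: ub_le_sup.
by rewrite sup_out.
Qed.

Lemma sup_sqr_le (R : realType) (A : set R) (M : R) : 0 <= M ->
  (forall x, A x -> 0 <= x /\ x ^+ 2 <= M) -> sup A ^+ 2 <= M.
Proof.
move=> M0 AM; have [->|/set0P A0] := eqVneq A set0.
  by rewrite sup0 expr0n.
have supA0 : 0 <= sup A by apply: sup_ge0 => x /AM[].
rewrite -(sqr_sqrtr M0) lerXn2r ?nnegrE ?sqrtr_ge0//.
apply: ge_sup => // x /AM[x0 xM].
by rewrite -(ger0_norm x0) -sqrtr_sqr ler_wsqrtr.
Qed.

Lemma mul_le_of_sumsqr (R : realType) (a b c : R) :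
  (a ^+ 2 + b ^+ 2) / 4 <= c -> a * b <= 2 * c.
Proof. by move=> abc; have := sqr_ge0 (a - b); nra. Qed.

Lemma add_le_of_sumsqr (R : realType) (a b c : R) :
  (a ^+ 2 + b ^+ 2) / 4 <= c -> a + b <= 2 * Num.sqrt 2 * Num.sqrt c.
Proof.
move=> abc.
have c0 : 0 <= c.
  by apply: le_trans abc; rewrite divr_ge0// addr_ge0// sqr_ge0.
apply: le_trans (ler_norm _) _.
rewrite -ler_sqr ?nnegrE ?mulr_ge0 ?sqrtr_ge0// real_normK ?num_real//.
rewrite !exprMn !sqr_sqrtr//.
by have := sqr_ge0 (a - b); nra.
Qed.

Section UnitVectors.
Variables (R : realType) (X : normedModType R).
Implicit Types (x y : X) (k t : R).

Lemma CNJ'_ge0 : 0 <= CNJ' X.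
Proof.
apply: sup_ge0 => _ [x _ [y _ <-]].
by rewrite divr_ge0// addr_ge0// sqr_ge0.
Qed.

(** Both norms are at most 2 on the unit sphere, which bounds the set whose
    supremum is [CNJ' X]; without this, [sup] would take its default value. *)
Lemma le_CNJ' x y : unit_sphere X x -> unit_sphere X y ->
  (`|x + y| ^+ 2 + `|x - y| ^+ 2) / 4 <= CNJ' X.
Proof.
move=> x1 y1; apply: ub_le_sup; last by exists x => //; exists y.
exists 2 => _ [u u1 [v v1 <-]].
have := ler_normD u v; have := ler_normB u v.
have := normr_ge0 (u + v); have := normr_ge0 (u - v).
by rewrite u1 v1; nra.
Qed.

Lemma norm_add_perturb k t x y : 0 < k -> unit_sphere X y ->
  `|k *: x + t *: y| <= k * `|x + y| + `|k - t|.
Proof.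
move=> k0 y1.
have -> : k *: x + t *: y = k *: (x + y) - (k - t) *: y.
  by rewrite scalerDr scalerBl opprB -addrA subrKC.
by rewrite (le_trans (ler_normB _ _))// !normrZ y1 mulr1 (gtr0_norm k0).
Qed.

(** The second factor is the first one for the pair [(- y, x)]. *)
Lemma norm_product_perturb k t x y : 0 < k ->
    unit_sphere X x -> unit_sphere X y ->
  `|k *: x + t *: y| * `|t *: x - k *: y|
    <= (k * `|x + y| + `|k - t|) * (k * `|x - y| + `|k - t|).
Proof.
move=> k0 x1 y1; apply: ler_pM => //; first exact: norm_add_perturb.
have := norm_add_perturb k t (- y) x k0 x1.
by rewrite scalerN ![- _ + _]addrC.
Qed.

End UnitVectors.

Theorem theorem4 (R : realType) (X : completeNormedModType R)
    (hdim : dim_ge X 2) (k t : R) (hk : 0 < k) (ht : 0 < t) :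
  T2 k t X ^+ 2 <=
    2 * k ^+ 2 * CNJ' X
    + 2 * Num.sqrt 2 * k * `|k - t| * Num.sqrt (CNJ' X)
    + (k - t) ^+ 2.
Proof.
have k0 := ltW hk.
have C0 := CNJ'_ge0 R X.
apply: sup_sqr_le.
  by do !apply: addr_ge0; rewrite ?sqr_ge0//; do !apply: mulr_ge0;
    rewrite ?sqrtr_ge0 ?sqr_ge0.
move=> _ [x x1 [y y1 <-]]; split; first exact: sqrtr_ge0.
rewrite sqr_sqrtr ?mulr_ge0//.
apply: le_trans (norm_product_perturb _ _ _ _ _ _ hk x1 y1) _.
have xyC := le_CNJ' _ _ _ _ x1 y1.
have abC := ler_wpM2l (sqr_ge0 k) (mul_le_of_sumsqr _ _ _ _ xyC).
have kd0 : 0 <= k * `|k - t| by rewrite mulr_ge0.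
have aDbC := ler_wpM2l kd0 (add_le_of_sumsqr _ _ _ _ xyC).
have <- : `|k - t| ^+ 2 = (k - t) ^+ 2 by rewrite real_normK ?num_real.
by lra.
Qed.
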